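(* Let $\mathbb{F}$ be a finite field, $d\ge 1$, $n\ge 0$, let $a_1,\dots,a_n\in\mathbb{F}^d$ and $b_1,\dots,b_n\in\mathbb{F}$, let $A_n\in\mathbb{F}^{n\times d}$ be the matrix with rows $a_1^\top,\dots,a_n^\top$, let $b^{(n)}=(b_1,\dots,b_n)^\top\in\mathbb{F}^n$, and let $W_n=\{w\in\mathbb{F}^d: A_nw=b^{(n)}\}$. Assume $W_n\neq\varnothing$. Then: (i) for any $w_0\in W_n$, $W_n=w_0+\operatorname{Ker}(A_n)$, so $\dim W_n=d-\operatorname{rank}(A_n)$ (dimension as an affine subspace); (ii) for a query $q\in\mathbb{F}^d$, all $w\in W_n$ induce the same answer $w^\top q$ if and only if $q\in\operatorname{Row}(A_n)$; (iii) if $\operatorname{rank}(A_n)=d$, then $W_n$ is a singleton and every query is determined, i.e. for every $q\in\mathbb{F}^d$ the value $w^\top q$ is the same for all $w\in W_n$; (iv) the number of remaining latent parameters is $|W_n|=|\mathbb{F}|^{d-\operatorname{rank}(A_n)}$.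
   Context: $\operatorname{Row}(A_n)\subseteq\mathbb{F}^d$ is the span of the rows of $A_n$ (identified with column vectors) and $\operatorname{Ker}(A_n)=\{u\in\mathbb{F}^d:A_nu=0\}$. Interpretation: a latent parameter $w$ defines the task $f(x)=w^\top x$ on $\mathbb{F}^d$; $W_n$ is the set of parameters consistent with the examples $(a_i,b_i)$. *)

(* Defs.v *)
From mathcomp Require Import all_boot all_order all_algebra.

Set Implicit Arguments.
Unset Strict Implicit.
Unset Printing Implicit Defensive.

Import GRing.Theory.
Local Open Scope ring_scope.

Definition example_mx (F : finFieldType) (d n : nat) (a : 'I_n -> 'cV[F]_d) :
  'M[F]_(n, d) := \matrix_(i < n) (a i)^T.

Definition label_vec (F : finFieldType) (n : nat) (b : 'I_n -> F) : 'cV[F]_n :=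
  \col_(i < n) b i.

Definition consistent (F : finFieldType) (d n : nat)
    (a : 'I_n -> 'cV[F]_d) (b : 'I_n -> F) : {set 'cV[F]_d} :=
  [set w | example_mx a *m w == label_vec b].

(* Mathcomp's kermx and the row space of a matrix in scope %MS live in row
   vectors (kermx A is the left kernel); the two spaces below are subspaces of
   the column space F^d. *)
Definition Ker (F : finFieldType) (d n : nat) (A : 'M[F]_(n, d)) :
  {vspace 'cV[F]_d} := lker (linfun (mulmx A : 'cV[F]_d -> 'cV[F]_n)).

Definition Row (F : finFieldType) (d n : nat) (A : 'M[F]_(n, d)) :
  {vspace 'cV[F]_d} := <<[seq (row i A)^T | i <- enum 'I_n]>>%VS.

Definition translate (F : finFieldType) (d : nat)
    (w0 : 'cV[F]_d) (U : {vspace 'cV[F]_d}) : {set 'cV[F]_d} :=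
  [set w0 + u | u in U].

(* The direction of an affine subspace S is the set of differences of points of
   S, which is already a subspace; the span makes it one for arbitrary S. *)
Definition direction (F : finFieldType) (d : nat) (S : {set 'cV[F]_d}) :
  {vspace 'cV[F]_d} := <<[seq u - v | u <- enum S, v <- enum S]>>%VS.

Definition affine_dim (F : finFieldType) (d : nat) (S : {set 'cV[F]_d}) : nat :=
  \dim (direction S).

Definition answer (F : finFieldType) (d : nat) (w q : 'cV[F]_d) : F :=
  (w^T *m q) 0 0.

(* Main.v *)
Require Import Defs.
From mathcomp Require Import all_boot all_order all_algebra.
From mathcomp Require Import finfield.

Set Implicit Arguments.
Unset Strict Implicit.
Unset Printing Implicit Defensive.

Import GRing.Theory.
Local Open Scope ring_scope.

(** The solution set of a consistent system is a translate of Ker A, and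
    rank-nullity gives its dimension and cardinality. A query q has the same
    answer on the whole set iff q is orthogonal to Ker A; testing q against the
    columns of the cokernel matrix of A, which lie in Ker A, shows that this
    means q is in the row space. *)

Section Subspaces.

Variables (F : finFieldType) (d n : nat).
Implicit Types (A : 'M[F]_(n, d)) (u q : 'cV[F]_d).

Lemma mem_Ker A u : (u \in Ker A) = (A *m u == 0).
Proof. by rewrite memv_ker lfunE. Qed.

(** Transposition carries the span of column vectors to a matrix row space, so the [submx] theory
    becomes available for [Row]. *)
Lemma mem_Row A q : (q \in Row A) = (q^T <= A)%MS.
Proof.
apply/idP/submxP => [|[v qvA]].
  rewrite /Row span_def big_map big_enum /= => /memv_sumP[vs vsP ->].
  (* Each summand [vs i] lies on the line of row [i]; the scalars, picked by [xchoose], form the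
     coefficient row vector. *)
  have c_ (i : 'I_n) : exists c, vs i == c *: (row i A)^T.
    by have /vlineP[c ->] := vsP i isT; exists c.
  exists (\row_i xchoose (c_ i)).
  rewrite mulmx_sum_row raddf_sum /=; apply: eq_bigr => i _.
  by rewrite mxE [in LHS](eqP (xchooseP (c_ i))) linearZ /= trmxK.
rewrite -[q]trmxK qvA mulmx_sum_row raddf_sum /= memv_suml // => i _.
rewrite linearZ /= memvZ ?memv_span //.
by rewrite (map_f (fun j => (row j A)^T)) ?mem_enum.
Qed.

(* Ker A is the injective image of row vectors under v |-> (v *m B)^T, where
   the rows of B form a basis of the left kernel of A^T. *)
Lemma dim_Ker A : \dim (Ker A) = (d - \rank A)%N.
Proof.
pose B := row_base (kermx A^T).
pose f := linfun (trmx \o mulmxr B : 'rV[F]_(\rank (kermx A^T)) -> 'cV[F]_d).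
have fE v : f v = (v *m B)^T by rewrite lfunE.
have f_inj : lker f == 0%VS.
  apply/lker0P => v w; rewrite !fE => /trmx_inj.
  exact: (row_free_inj (row_base_free _)).
have -> : Ker A = limg f.
  apply/vspaceP => u; rewrite mem_Ker; apply/eqP/memv_imgP => [Au0 | [v _ ->]].
    have /submxP[v uvB] : (u^T <= B)%MS.
      by rewrite eq_row_base; apply/sub_kermxP; rewrite -trmx_mul Au0 trmx0.
    by exists v; rewrite ?memvf // fE -uvB trmxK.
  apply: trmx_inj; rewrite fE trmx_mul trmxK trmx0; apply/sub_kermxP.
  by apply: submx_trans (submxMl _ _) _; rewrite eq_row_base.
(* By injectivity the image has the dimension of the domain, the rank of [kermx A^T]. *)
rewrite limg_dim_eq ?(eqP f_inj) ?capv0 // dimvf /dim /= mul1n.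
by rewrite mxrank_ker mxrank_tr.
Qed.

Lemma RowP A q : reflect {in Ker A, forall u, answer u q = 0} (q \in Row A).
Proof.
rewrite mem_Row; apply: (iffP submxP) => [[v qvA] u|qKer0].
  rewrite mem_Ker => /eqP Au0; rewrite /answer -[q]trmxK qvA -trmx_mul.
  by rewrite -mulmxA Au0 mulmx0 trmx0 mxE.
apply/submxP; rewrite submxE; apply/eqP/rowP => j.
have /qKer0 : col j (cokermx A) \in Ker A.
  by rewrite mem_Ker colE mulmxA mulmx_coker mul0mx.
(* Entry [j] of [q^T *m cokermx A] is the answer of column [j] up to transposing a scalar. *)
rewrite /answer => qj; rewrite [RHS]mxE -[RHS]qj.
rewrite -[in RHS](trmxK q) -trmx_mul !mxE; apply: eq_bigr => k _.
by rewrite [col _ _ _ _]mxE.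
Qed.

End Subspaces.

Section Translates.

Variables (F : finFieldType) (d : nat).
Implicit Types (w q : 'cV[F]_d) (U : {vspace 'cV[F]_d}).

Lemma mem_translate w U (x : 'cV[F]_d) : (x \in translate w U) = (x - w \in U).
Proof.
apply/imsetP/idP => [[u Uu ->]|Uxw]; first by rewrite addrC addKr.
by exists (x - w); rewrite // addrC subrK.
Qed.

Lemma card_translate w U : #|translate w U| = (#|F| ^ \dim U)%N.
Proof. by rewrite card_imset ?card_vspace //; apply: addrI. Qed.

(** The base point cancels in differences, and each [u] in [U] is the difference of [w + u] and
    [w]. *)
Lemma direction_translate w U : direction (translate w U) = U.
Proof.
apply/eqP; rewrite eqEsubv; apply/andP; split.
  apply/span_subvP => _ /allpairsP[[x y] [/= xU yU ->]].
  rewrite !mem_enum !mem_translate in xU yU.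
  by rewrite -(subrKA w) -[w - y]opprB memvB.
apply/subvP => u Uu; apply: memv_span; apply/allpairsP.
by exists (w + u, w); rewrite !mem_enum !mem_translate /= addrAC subrr add0r
  mem0v.
Qed.

Lemma answerB w w' q : answer (w - w') q = answer w q - answer w' q.
Proof. by rewrite /answer linearB /= mulmxBl !mxE. Qed.

(** Answers are additive in the parameter, so comparing every point with the base point [w]
    suffices. *)
Lemma constant_answer_translate w U q :
  {in translate w U &, forall x y : 'cV[F]_d, answer x q = answer y q}
  <-> {in U, forall u, answer u q = 0}.
Proof.
split=> [qC u Uu | q0 x y].
  rewrite -[u](addKr w) addrC answerB (qC _ w) ?subrr // mem_translate.
    by rewrite addrC addKr.
  by rewrite subrr mem0v.
rewrite !mem_translate => /q0 + /q0.
by rewrite !answerB => /eqP + /eqP; rewrite !subr_eq0 => /eqP-> /eqP->.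
Qed.

End Translates.

Lemma consistent_translate (F : finFieldType) (d n : nat)
    (a : 'I_n -> 'cV[F]_d) (b : 'I_n -> F) (w0 : 'cV[F]_d) :
  w0 \in consistent a b -> consistent a b = translate w0 (Ker (example_mx a)).
Proof.
rewrite inE => /eqP Aw0; apply/setP => w.
by rewrite mem_translate mem_Ker inE mulmxBr Aw0 subr_eq0.
Qed.

Theorem theorem5p1 (F : finFieldType) (d n : nat) (hd : (1 <= d)%N)
    (a : 'I_n -> 'cV[F]_d) (b : 'I_n -> F)
    (hW : consistent a b != set0) :
  [/\ (forall w0 : 'cV[F]_d, w0 \in consistent a b ->
         consistent a b = translate w0 (Ker (example_mx a)))
      /\ affine_dim (consistent a b) = (d - \rank (example_mx a))%N,
      forall q : 'cV[F]_d,
        {in consistent a b &, forall w w' : 'cV[F]_d, answer w q = answer w' q}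
        <-> q \in Row (example_mx a),
      \rank (example_mx a) = d ->
        (exists w : 'cV[F]_d, consistent a b = [set w])
        /\ (forall q : 'cV[F]_d,
              {in consistent a b &,
                 forall w w' : 'cV[F]_d, answer w q = answer w' q})
    & #|consistent a b| = (#|F| ^ (d - \rank (example_mx a)))%N].
Proof.
have [w0 /consistent_translate defW] := set0Pn _ hW.
have cardW : #|consistent a b| = (#|F| ^ (d - \rank (example_mx a)))%N.
  by rewrite defW card_translate dim_Ker.
split=> //.
- split=> [w|]; first exact: consistent_translate.
  by rewrite /affine_dim defW direction_translate dim_Ker.
- move=> q; rewrite defW; apply: iff_trans (rwP (RowP _ _)).
  exact: constant_answer_translate.
(* Uniqueness comes from counting: at full rank the cardinality is [#|F| ^ 0]. *)
- move=> rkA; have /cards1P[w defWw] : #|consistent a b| == 1%N.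
    by rewrite cardW rkA subnn.
  split; first by exists w.
  by move=> q x y; rewrite defWw !inE => /eqP-> /eqP->.
Qed.
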